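(* Let $n\ge1$. The ring $A_{fin}[\widetilde{Sp}(\mathbb{A}^1_n)]$ is the polynomial $\mathbb{R}$-algebra freely generated by the elements $p_{\mathbf a,\mathbf b}$ with $\mathbf a\in\mathbb{N}_+^n$ (i.e. $a_j\ge1$ for all $j$) and $\mathbf b\in\mathbb{N}^n$; that is, these elements are algebraically independent over $\mathbb{R}$ and generate $A_{fin}[\widetilde{Sp}(\mathbb{A}^1_n)]$ as an $\mathbb{R}$-algebra.
   Context: Fix $n\ge1$. For $m\ge1$ let $P_m=\mathbb{R}[x_{ij},y_{ij}]_{1\le i\le m,\,1\le j\le n}$, graded by total degree. $S_m$ acts on $P_m$ by permuting the block index $i$ simultaneously in the $x$ and $y$ variables; $A_m=P_m^{S_m}$. Let $\pi_m:A_{m+1}\to A_m$ set $x_{m+1,j}=y_{m+1,j}=0$. Let $A^\infty_{fin}=\varprojlim_m A_m$ in the category of graded rings (finite sums of compatible families $(f_m)$ of homogeneous elements of common degree). For a finite multiset $X=\{(\mathbf{x}_1,\mathbf{y}_1),\dots,(\mathbf{x}_r,\mathbf{y}_r)\}\subset\mathbb{R}^n\times\mathbb{R}^n$ and $f\in A^\infty_{fin}$, $\varphi_X(f)=f_m(\mathbf{x}_1,\mathbf{y}_1,\dots,\mathbf{x}_r,\mathbf{y}_r,0,\dots,0)$ for any $m\ge r$. A pair $(\mathbf z,\mathbf z')\in\mathbb{R}^n\times\mathbb{R}^n$ is degenerate if $z_j=z'_j$ for some $j$. $A_{fin}[\widetilde{Sp}(\mathbb{A}^1_n)]$ is the set of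 $f\in A^\infty_{fin}$ with $\varphi_{X\cup\{(\mathbf z,\mathbf z')\}}(f)=\varphi_X(f)$ for every finite multiset $X$ and every degenerate pair $(\mathbf z,\mathbf z')$. Write $\eta_{ij}=y_{ij}-x_{ij}$, $\xi_{ij}=y_{ij}+x_{ij}$. For $\mathbf a\in\mathbb{N}_+^n$, $\mathbf b\in\mathbb{N}^n$, $p_{\mathbf a,\mathbf b}\in A^\infty_{fin}$ is the compatible family $\big(\sum_{i=1}^m\prod_{j=1}^n\eta_{ij}^{a_j}\xi_{ij}^{b_j}\big)_{m\ge1}$, of degree $\sum_j(a_j+b_j)$. *)

(* Defs.v *)
From HB Require Import structures.
From mathcomp Require Import all_boot all_order all_algebra all_fingroup.
Set Implicit Arguments. Unset Strict Implicit. Unset Printing Implicit Defensive.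
Import Order.TTheory GRing.Theory Num.Theory.
Local Open Scope ring_scope.

Section MPoly.
Variable R : comNzRingType.

(* mpoly k = R[X_0,...,X_{k-1}], with X_{k-1} the outermost variable *)
Fixpoint mpoly (k : nat) : comNzRingType :=
  match k with
  | 0 => R
  | k'.+1 => ({poly mpoly k'} : comNzRingType)
  end.

Fixpoint mpC (k : nat) : R -> mpoly k :=
  match k as k0 return R -> mpoly k0 with
  | 0 => fun r => r
  | k'.+1 => fun r => ((mpC k' r)%:P : {poly mpoly k'})
  end.

(* the variable X_i (i < k); X_i := 0 if i >= k (never used) *)
Fixpoint mpX (k : nat) (i : nat) : mpoly k :=
  match k as k0 return mpoly k0 with
  | 0 => 0
  | k'.+1 => (if i == k' then 'X else (mpX k' i)%:P : {poly mpoly k'})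
  end.

Fixpoint mpEval (S : comNzRingType) (c : R -> S) (v : nat -> S) (k : nat)
  : mpoly k -> S :=
  match k as k0 return mpoly k0 -> S with
  | 0 => fun p => c p
  | k'.+1 => fun p => (map_poly (@mpEval S c v k') (p : {poly mpoly k'})).[v k']
  end.

Fixpoint mhom (k : nat) : nat -> mpoly k -> Prop :=
  match k as k0 return nat -> mpoly k0 -> Prop with
  | 0 => fun d p => p != 0 -> d = 0%N
  | k'.+1 => fun d p =>
      forall i : nat,
        ((d < i)%N -> (p : {poly mpoly k'})`_i = 0) /\
        @mhom k' (d - i)%N (p : {poly mpoly k'})`_i
  end.

End MPoly.

Section Sp.
Variable R : realFieldType.
Variable n : nat.

Definition Pm (m : nat) : comNzRingType := mpoly R (m * (2 * n)).

Definition xvar (m i j : nat) : Pm m := mpX R (m * (2 * n)) (i * (2 * n) + j).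
Definition yvar (m i j : nat) : Pm m := mpX R (m * (2 * n)) (i * (2 * n) + n + j).

Definition permP (m : nat) (s : 'S_m) (f : Pm m) : Pm m :=
  mpEval (@mpC R _) (fun l : nat =>
    match (insub (l %/ (2 * n))%N : option 'I_m) with
    | Some i => mpX R (m * (2 * n)) ((s i : nat) * (2 * n) + l %% (2 * n))
    | None => mpX R (m * (2 * n)) l
    end) f.

Definition inAm (m : nat) (f : Pm m) : Prop := forall s : 'S_m, permP s f = f.

Definition proj (m : nat) (f : Pm m.+1) : Pm m :=
  mpEval (@mpC R _)
    (fun l : nat => if (l < m * (2 * n))%N then mpX R (m * (2 * n)) l else 0) f.

(* families (f_m)_{m >= 1}; component F m lives in P_{m+1} *)
Definition fam := forall m : nat, Pm m.+1.

Definition fam_compat (F : fam) : Prop := forall m : nat, proj (F m.+1) = F m.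

Definition fam_sym (F : fam) : Prop := forall m : nat, inAm (F m).

Definition fam_hom (d : nat) (F : fam) : Prop :=
  forall m : nat, mhom d (F m).

Definition inAinf (F : fam) : Prop :=
  exists (D : nat) (G : nat -> fam),
    (forall d : nat, fam_sym (G d) /\ fam_compat (G d) /\ fam_hom d (G d)) /\
    (forall m : nat, F m = \sum_(d < D) G d m).

(* phi_X(f) = f_m(x_1,y_1,...,x_r,y_r,0,...,0), here with m = r+1 *)
Definition point := (('I_n -> R) * ('I_n -> R))%type.

Definition ptval (X : seq point) (l : nat) : R :=
  let i := (l %/ (2 * n))%N in
  let r := (l %% (2 * n))%N in
  if (i < size X)%N then
    let P := nth ((fun _ => 0), (fun _ => 0)) X i in
    match (insub r : option 'I_n) with
    | Some j => P.1 j
    | None =>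
        match (insub (r - n)%N : option 'I_n) with
        | Some j => P.2 j
        | None => 0
        end
    end
  else 0.

Definition phi (X : seq point) (F : fam) : R :=
  mpEval (fun r : R => r) (ptval X) (F (size X)).

Definition degenerate (z : point) : Prop := exists j : 'I_n, z.1 j = z.2 j.

Definition inSp (F : fam) : Prop :=
  inAinf F /\
  forall (X : seq point) (z : point), degenerate z -> phi (z :: X) F = phi X F.

Definition abidx := ({ffun 'I_n -> nat} * {ffun 'I_n -> nat})%type.

Definition pfam (ab : abidx) : fam := fun m =>
  \sum_(i < m.+1) \prod_(j < n)
     ((yvar m.+1 i j - xvar m.+1 i j) ^+ ab.1 j *
      (yvar m.+1 i j + xvar m.+1 i j) ^+ ab.2 j).

Definition admissible (ab : abidx) : Prop := forall j : 'I_n, (0 < ab.1 j)%N.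

(* Q(p_{idx 0}, ..., p_{idx (k-1)}) computed componentwise (the ring
   structure of the inverse limit is componentwise) *)
Definition evalQ (k : nat) (idx : 'I_k -> abidx) (Q : mpoly R k) : fam :=
  fun m => mpEval (@mpC R _)
    (fun l : nat => match (insub l : option 'I_k) with
                    | Some i => pfam (idx i) m
                    | None => 0
                    end) Q.

End Sp.

(* Main.v *)
Require Import Defs.
From HB Require Import structures.
From mathcomp Require Import all_boot all_order all_algebra all_fingroup.
From mathcomp Require Import zify ring.
Set Implicit Arguments. Unset Strict Implicit. Unset Printing Implicit Defensive.
Import GRing.Theory Num.Theory.
Local Open Scope ring_scope.

(* An element [f] of [A^infty_fin] is read as a function on finite sequences [X]
   of points, X |-> phi_X(f).

   Generation, by induction on the degree [d] of a homogeneous [f] satisfying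
   the degeneracy condition.  Expand f(z, X) = sum_u u(z) f_u(X) over monomials
   [u] in the [eta_j], [xi_j].  Each [f_u] is a fixed linear combination of
   functions f(z_s, X), hence is again symmetric, homogeneous (of degree
   d - |u|) and insensitive to degenerate pairs; invariance of [f] under
   degenerate [z] forces f_u = 0 when [u] is nonconstant and misses some
   [eta_j].  Euler's identity reads
     d f(X) = sum_i sum_u |u| u(z_i) f_u(X \ z_i).
   Inductively [f_u] is a polynomial in the power sums, whose value at X \ z_i
   is obtained by substituting p(X) - p(z_i) for each p, so the right-hand side
   is a polynomial in the p_(a,b) with [a] positive.

   Independence: the vectors (p_i(X))_i form an additive monoid spanning R^k,
   because distinct monomials are linearly independent functions, so no nonzero
   polynomial vanishes on it. *)

(** * Evaluation of iterated polynomial rings *)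

Section Evaluation.
Variables (R S : comNzRingType).
Implicit Types (c : {rmorphism R -> S}) (v w : nat -> S).

(** The recursion must carry a bundled morphism, since at each level [map_poly] is multiplicative
    only along one; the canonical instances are transported from it. *)
Lemma mpEval_rmorphism c v k :
  exists g : {rmorphism mpoly R k -> S}, g =1 @mpEval R S c v k.
Proof.
elim: k => [|k [g gE]] /=; first by exists c.
pose h : {rmorphism {poly mpoly R k} -> S} := horner_eval (v k) \o map_poly g.
by exists h => p; rewrite /h /= /horner_eval (eq_map_poly gE).
Qed.

Lemma mpEval_is_zmod_morphism c v k : zmod_morphism (@mpEval R S c v k).
Proof. by have [g gE] := mpEval_rmorphism c v k => p q; rewrite -!gE rmorphB. Qed.

Lemma mpEval_is_monoid_morphism c v k : monoid_morphism (@mpEval R S c v k).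
Proof.
have [g gE] := mpEval_rmorphism c v k.
by split=> [|p q]; rewrite -!gE ?rmorph1 ?rmorphM.
Qed.

HB.instance Definition _ c v k :=
  GRing.isZmodMorphism.Build (mpoly R k) S (@mpEval R S c v k)
    (@mpEval_is_zmod_morphism c v k).
HB.instance Definition _ c v k :=
  GRing.isMonoidMorphism.Build (mpoly R k) S (@mpEval R S c v k)
    (@mpEval_is_monoid_morphism c v k).

Lemma mpEvalS c v k (p : {poly mpoly R k}) :
  @mpEval R S c v k.+1 p = \sum_(i < size p) mpEval c v p`_i * v k ^+ i.
Proof. by rewrite /= /map_poly horner_poly. Qed.

Lemma mpEval_C c v k r : mpEval c v (mpC k r) = c r.
Proof. by elim: k => [|k IHk] //=; rewrite map_polyC /= hornerC. Qed.

Lemma mpEval_X c v k i : (i < k)%N -> mpEval c v (mpX R k i) = v i.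
Proof.
elim: k => [|k IHk] // lt_ik /=; case: eqP => [-> | /eqP ne_ik].
  by rewrite map_polyX hornerX.
by rewrite map_polyC /= hornerC IHk // ltn_neqAle ne_ik -ltnS.
Qed.

Lemma eq_mpEval c v w k : (forall l, (l < k)%N -> v l = w l) ->
  @mpEval R S c v k =1 @mpEval R S c w k.
Proof.
elim: k => [|k IHk] vw p //=; rewrite vw //.
by rewrite (eq_map_poly (IHk _)) // => l ltlk; apply/vw/ltnW.
Qed.

End Evaluation.

Lemma mpC_is_rmorphism (R : comNzRingType) k :
  exists g : {rmorphism R -> mpoly R k}, g =1 @mpC R k.
Proof.
elim: k => [|k [g gE]]; first by exists idfun.
by exists (polyC \o g) => r /=; rewrite gE.
Qed.

Lemma mpC_is_zmod_morphism (R : comNzRingType) k : zmod_morphism (@mpC R k).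
Proof. by have [g gE] := mpC_is_rmorphism R k => p q; rewrite -!gE rmorphB. Qed.

Lemma mpC_is_monoid_morphism (R : comNzRingType) k : monoid_morphism (@mpC R k).
Proof.
have [g gE] := mpC_is_rmorphism R k.
by split=> [|p q]; rewrite -!gE ?rmorph1 ?rmorphM.
Qed.

HB.instance Definition _ (R : comNzRingType) k :=
  GRing.isZmodMorphism.Build R (mpoly R k) (@mpC R k) (@mpC_is_zmod_morphism R k).
HB.instance Definition _ (R : comNzRingType) k :=
  GRing.isMonoidMorphism.Build R (mpoly R k) (@mpC R k)
    (@mpC_is_monoid_morphism R k).

Lemma rmorph_mpEval (R S T : comNzRingType) (c : {rmorphism R -> S})
    (g : {rmorphism S -> T}) (d : {rmorphism R -> T}) v k (P : mpoly R k) :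
  g \o c =1 d -> g (mpEval c v P) = mpEval d (g \o v) P.
Proof.
move=> gc; elim: k P => [|k IHk] P; first exact: gc.
rewrite !mpEvalS rmorph_sum /=; apply: eq_bigr => i _.
by rewrite rmorphM rmorphXn IHk.
Qed.

(** * Polynomials as functions over an infinite field *)

Section InfiniteField.
Variable R : realFieldType.

(** A nonzero polynomial has fewer roots than its size, and naturals are distinct in [R]. The
    witness is a natural number so that it can later serve as the multiplicity of a point. *)
Lemma poly_neq0_nat (q : {poly R}) : q != 0 -> exists c : nat, q.[c%:R] != 0.
Proof.
move=> q0; pose rs := [seq i%:R : R | i <- iota 0 (size q)].
have : ~~ all (root q) rs.
  apply/negP=> rs_q; suff: (size rs < size q)%N by rewrite size_map size_iota ltnn.
  apply: max_poly_roots => //; rewrite map_inj_uniq ?iota_uniq //.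
  by move=> i j /eqP; rewrite eqr_nat => /eqP.
by case/allPn=> _ /mapP[i _ ->] qi; exists i.
Qed.

Lemma poly_eq0_eval (q : {poly R}) : (forall x, q.[x] = 0) -> q = 0.
Proof.
move=> q0; apply/eqP; apply: contraT => /poly_neq0_nat[c].
by rewrite q0 eqxx.
Qed.

(** Choose the inner variables so that the leading coefficient survives, then the outermost one. *)
Lemma mpoly_neq0_eval k (P : mpoly R k) :
  P != 0 -> exists v, mpEval idfun v P != 0.
Proof.
elim: k P => [|k IHk] P P0; first by exists (fun=> 0).
have [v Pv] : exists v, mpEval idfun v (lead_coef (P : {poly mpoly R k})) != 0.
  by apply: IHk; rewrite lead_coef_eq0.
have [|c Pc] := @poly_neq0_nat (map_poly (mpEval idfun v (k := k)) P).
  apply: contraNneq Pv => /polyP/(_ (size (P : {poly mpoly R k})).-1).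
  by rewrite coef_map coef0 /= => ->.
exists (fun l => if l == k then c%:R else v l); rewrite /= eqxx.
apply: contraNneq Pc => <-; apply/eqP; congr (_.[_]).
by apply/eq_map_poly/eq_mpEval => l ltlk; rewrite (ltn_eqF ltlk).
Qed.

Lemma mpoly_eq0_eval k (P : mpoly R k) :
  (forall v, mpEval idfun v P = 0) -> P = 0.
Proof.
move=> P0; apply/eqP; apply: contraT => /mpoly_neq0_eval[v].
by rewrite P0 eqxx.
Qed.

Lemma mpoly_eq_eval k (P Q : mpoly R k) :
  (forall v, mpEval idfun v P = mpEval idfun v Q) -> P = Q.
Proof.
move=> PQ; apply/eqP; rewrite -subr_eq0; apply/eqP; apply: mpoly_eq0_eval => v.
by rewrite rmorphB /= PQ subrr.
Qed.

Lemma mpEval_comp k m (v : nat -> R) (w : nat -> mpoly R m) (P : mpoly R k) :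
  mpEval idfun v (mpEval (@mpC R m) w P) =
  mpEval idfun (fun l => mpEval idfun v (w l)) P.
Proof. by apply: rmorph_mpEval => r /=; rewrite mpEval_C. Qed.

End InfiniteField.

(** Residues modulo [b] give the lowest digit, quotients the others. This makes the Kronecker
    exponents injective. *)
Lemma digits_inj b m (f g : 'I_m -> nat) :
  (forall i, f i < b)%N -> (forall i, g i < b)%N ->
  (\sum_i f i * b ^ i = \sum_i g i * b ^ i)%N -> f =1 g.
Proof.
elim: m f g => [|m IHm] f g ltf ltg; first by move=> _ [].
have b0 : (0 < b)%N by apply: leq_ltn_trans (ltf ord0).
have shift (h : 'I_m.+1 -> nat) : (\sum_i h i * b ^ i =
    (\sum_(i < m) h (lift ord0 i) * b ^ i) * b + h ord0)%N.
  rewrite big_ord_recl expn0 muln1 addnC; congr (_ + _)%N.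
  rewrite big_distrl /=; apply: eq_bigr => i _.
  by rewrite /bump /= add1n expnSr mulnA.
rewrite !shift => eq_fg.
have eq0 : f ord0 = g ord0.
  by have := congr1 (modn^~ b) eq_fg; rewrite !modnMDl !modn_small.
have eqS : (fun i => f (lift ord0 i)) =1 (fun i => g (lift ord0 i)).
  apply: IHm => // ; have := congr1 (divn^~ b) eq_fg.
  by rewrite !divnMDl // !divn_small // !addn0.
by move=> i; case: (unliftP ord0 i) => [j ->|->] //; apply: eqS.
Qed.

(** * Monomials in eta and xi, and functions of one point of bounded degree *)

Section Monomials.
Variables (R : realFieldType) (n : nat).
Implicit Types (z : point R n) (u v ab : abidx n) (t : R).

Definition mon ab z : R :=
  \prod_j ((z.2 j - z.1 j) ^+ ab.1 j * (z.2 j + z.1 j) ^+ ab.2 j).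

Definition wt ab : nat := (\sum_j (ab.1 j + ab.2 j))%N.

Definition scale t z : point R n := (fun j => t * z.1 j, fun j => t * z.2 j).

Definition of_eta_xi (e x : 'I_n -> R) : point R n :=
  (fun j => (x j - e j) / 2, fun j => (x j + e j) / 2).

Definition idx0 : abidx n := ([ffun => 0%N], [ffun => 0%N]).

Definition idxD u v : abidx n :=
  ([ffun j => u.1 j + v.1 j]%N, [ffun j => u.2 j + v.2 j]%N).

Lemma mon_of_eta_xi ab e x :
  mon ab (of_eta_xi e x) = \prod_j (e j ^+ ab.1 j * x j ^+ ab.2 j).
Proof.
by apply: eq_bigr => j _ /=; congr (_ ^+ _ * _ ^+ _); field.
Qed.

Lemma mon_scale ab t z : mon ab (scale t z) = t ^+ wt ab * mon ab z.
Proof.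
rewrite /mon /wt expr_sum -big_split /=; apply: eq_bigr => j _.
by rewrite -mulrBr -mulrDr !exprMn exprD; ring.
Qed.

Lemma mon0 z : mon idx0 z = 1.
Proof. by apply: big1 => j _; rewrite !ffunE !expr0 mulr1. Qed.

Lemma monD u v z : mon (idxD u v) z = mon u z * mon v z.
Proof.
rewrite /mon -big_split /=; apply: eq_bigr => j _.
by rewrite !ffunE !exprD; ring.
Qed.

Lemma wt0 : wt idx0 = 0%N.
Proof. by apply: big1 => j _; rewrite !ffunE. Qed.

Lemma wtD u v : wt (idxD u v) = (wt u + wt v)%N.
Proof.
by rewrite /wt -big_split /=; apply: eq_bigr => j _; rewrite !ffunE addnACA.
Qed.

Lemma leq_wt u j : (u.1 j + u.2 j <= wt u)%N.
Proof. by rewrite /wt (bigD1 j) //= leq_addr. Qed.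

Lemma admissibleDl u v : admissible u -> admissible (idxD u v).
Proof. by move=> u0 j; rewrite ffunE addn_gt0 u0. Qed.

(* Kronecker substitution: at the [s]-th point the monomial [idx u] takes the
   value [lam u ^+ s] with [lam] injective, so that the matrix of values is a
   Vandermonde matrix. *)
Lemma mon_interpolation (K : finType) (idx : K -> abidx n) : injective idx ->
  exists k (zs : 'I_k -> point R n) (C : K -> 'I_k -> R),
    forall u u' : K, \sum_s C u s * mon (idx u') (zs s) = (u == u')%:R.
Proof.
move=> idx_inj; pose B := (\sum_(u : K) wt (idx u)).+1.
have ltB (u : K) j : ((idx u).1 j + (idx u).2 j < B)%N.
  by rewrite ltnS (leq_trans (leq_wt _ j)) // (bigD1 u) //= leq_addr.
(* The two exponents at [j] are the base-[B] digits of [dig u j], and these are in turn the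
   base-[B ^ 2] digits of [e u]. *)
pose dig (u : K) j := ((idx u).1 j + B * (idx u).2 j)%N.
pose e (u : K) := (\sum_j dig u j * (B ^ 2) ^ j)%N.
have e_inj : injective e.
  move=> u u' /digits_inj eq_dig; apply: idx_inj.
  have {}eq_dig : dig u =1 dig u'.
    have lt_dig w j : (dig w j < B ^ 2)%N.
      have := ltB w j; rewrite /dig -mulnn; move: {ltB eq_dig e dig} B => b lt_b.
      have : (b * ((idx w).2 j).+1 <= b * b)%N by rewrite leq_mul2l; lia.
      by rewrite mulnS; lia.
    exact: eq_dig.
  have eqj j : (idx u).1 j = (idx u').1 j /\ (idx u).2 j = (idx u').2 j.
    have lta (w : K) : ((idx w).1 j < B)%N by have := ltB w j; lia.
    have eq_a : (idx u).1 j = (idx u').1 j.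
      have := congr1 (modn^~ B) (eq_dig j).
      by rewrite /dig ![(B * _)%N]mulnC ![(_ + _ * B)%N]addnC !modnMDl !modn_small.
    split=> //; have := eq_dig j; rewrite /dig eq_a => /addnI/eqP.
    by rewrite eqn_mul2l => /predU1P[//|/eqP].
  case: (idx u) (idx u') eqj => [a b] [a' b'] /= eqj.
  by congr (_, _); apply/ffunP=> j; have [] := eqj j.
pose lam (u : K) : R := 2 ^+ e u.
have lam_inj : injective lam.
  by move=> u u' /ieexprIn eq_e; apply/e_inj/eq_e; rewrite ?ltr0n ?(eqr_nat _ 2 1).
pose zs (s : 'I_#|K|) : point R n :=
  of_eta_xi (fun j => 2 ^+ ((B ^ 2) ^ j * s)) (fun j => 2 ^+ (B * (B ^ 2) ^ j * s)).
pose V := Vandermonde #|K| (\row_(i < #|K|) lam (enum_val i)).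
have VE (u : K) s : mon (idx u) (zs s) = V s (enum_rank u).
  rewrite !mxE enum_rankK mon_of_eta_xi /lam -exprM /e big_distrl /= expr_sum.
  apply: eq_bigr => j _; rewrite -!exprM -exprD /dig; congr (_ ^+ _); lia.
have Vunit : V \in unitmx.
  rewrite unitmxE det_Vandermonde unitfE prodf_seq_neq0.
  apply/allP=> i _; apply/implyP=> _; rewrite prodf_seq_neq0.
  apply/allP=> j _; apply/implyP=> ltij; rewrite !mxE subr_eq0.
  by apply: contraTneq ltij => /lam_inj/enum_val_inj->; rewrite ltnn.
(* Row [u] of the inverse matrix extracts the coefficient of [idx u]. *)
exists #|K|, zs, (fun (u : K) s => invmx V (enum_rank u) s) => u u'.
have := congr1 (fun M : 'M__ => M (enum_rank u) (enum_rank u')) (mulVmx Vunit).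
rewrite !mxE (inj_eq enum_rank_inj) => <-; apply: eq_bigr => s _.
by rewrite VE.
Qed.

(** Polynomial functions of degree at most [d]; the clause [poly_le_ext] closes them under pointwise
    equality, in place of function extensionality. *)
Inductive poly_le (d : nat) : (point R n -> R) -> Prop :=
| poly_le_mon c u : (wt u <= d)%N -> poly_le d (fun z => c * mon u z)
| poly_le_add f g : poly_le d f -> poly_le d g -> poly_le d (fun z => f z + g z)
| poly_le_ext f g : f =1 g -> poly_le d f -> poly_le d g.

Lemma poly_le_const d c : poly_le d (fun=> c).
Proof.
apply: (@poly_le_ext _ (fun z => c * mon idx0 z)) => [z|].
  by rewrite mon0 mulr1.
by apply: poly_le_mon; rewrite wt0.
Qed.

Lemma poly_le_mul d1 d2 f g : poly_le d1 f -> poly_le d2 g ->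
  poly_le (d1 + d2) (fun z => f z * g z).
Proof.
move=> Pf; elim: Pf g => {f} [c u le_u g|f1 f2 _ IH1 _ IH2 g Pg|f f' ff' _ IH g Pg].
- elim=> {g} [c' v le_v|g1 g2 _ IH1 _ IH2|g g' gg' _ IH].
  + apply: (@poly_le_ext _ (fun z => (c * c') * mon (idxD u v) z)) => [z|].
      by rewrite monD; ring.
    by apply: poly_le_mon; rewrite wtD leq_add.
  + by apply: poly_le_ext (poly_le_add IH1 IH2) => z; rewrite mulrDr.
  + by apply: poly_le_ext IH => z; rewrite gg'.
- by apply: poly_le_ext (poly_le_add (IH1 g Pg) (IH2 g Pg)) => z; rewrite mulrDl.
- by apply: poly_le_ext (IH g Pg) => z; rewrite ff'.
Qed.

Lemma poly_le_exp f i : poly_le 1 f -> poly_le i (fun z => f z ^+ i).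
Proof.
move=> Pf; elim: i => [|i IHi].
  by apply: poly_le_ext (poly_le_const 0 1) => z; rewrite expr0.
rewrite -[i.+1]add1n.
by apply: poly_le_ext (poly_le_mul Pf IHi) => z; rewrite exprS.
Qed.

Lemma poly_le_sum d k (f : 'I_k -> point R n -> R) :
  (forall i, poly_le d (f i)) -> poly_le d (fun z => \sum_i f i z).
Proof.
elim: k f => [|k IHk] f Pf.
  by apply: poly_le_ext (poly_le_const d 0) => z; rewrite big_ord0.
apply: poly_le_ext (poly_le_add (Pf ord0) (IHk (fun i => f (lift ord0 i)) _)).
  by move=> z; rewrite big_ord_recl.
by move=> i; apply: Pf.
Qed.

(** Invert the change of variables: x = (xi - eta)/2 and y = (xi + eta)/2. *)
Lemma poly_le_coord j : poly_le 1 (fun z => z.1 j) /\ poly_le 1 (fun z => z.2 j).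
Proof.
pose d i := [ffun j' => (j' == i : nat)] : {ffun 'I_n -> nat}.
pose e : abidx n := (d j, [ffun => 0%N]); pose x : abidx n := ([ffun => 0%N], d j).
have we : (wt e <= 1)%N.
  by rewrite /wt (bigD1 j) //= big1 ?addn0 ?ffunE ?eqxx // => i /negPf ij; rewrite !ffunE ij.
have wx : (wt x <= 1)%N.
  by rewrite /wt (bigD1 j) //= big1 ?addn0 ?ffunE ?eqxx // => i /negPf ij; rewrite !ffunE ij.
have eE z : mon e z = z.2 j - z.1 j.
  rewrite /mon (bigD1 j) //= big1 ?mulr1 ?ffunE ?eqxx ?expr1 ?mulr1 // => i /negPf ij.
  by rewrite !ffunE ij !expr0 mulr1.
have xE z : mon x z = z.2 j + z.1 j.
  rewrite /mon (bigD1 j) //= big1 ?mulr1 ?ffunE ?eqxx ?expr1 ?mul1r // => i /negPf ij.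
  by rewrite !ffunE ij !expr0 mulr1.
split.
- apply: poly_le_ext (poly_le_add (poly_le_mon (-2^-1) we) (poly_le_mon 2^-1 wx)).
  by move=> z /=; rewrite eE xE; field.
- apply: poly_le_ext (poly_le_add (poly_le_mon 2^-1 we) (poly_le_mon 2^-1 wx)).
  by move=> z /=; rewrite eE xE; field.
Qed.

(** A finite type containing all exponents of weight at most [N], so that expansions are sums over a
    [finType]. It also holds some larger weights. *)
Definition box N : finType := ({ffun 'I_n -> 'I_N.+1} * {ffun 'I_n -> 'I_N.+1})%type.

Definition box_idx N (u : box N) : abidx n :=
  ([ffun j => u.1 j : nat], [ffun j => u.2 j : nat]).

Lemma box_idx_inj N : injective (@box_idx N).
Proof.
move=> [a b] [a' b'] [/ffunP eq_a /ffunP eq_b].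
congr (_, _); apply/ffunP=> j; apply: val_inj.
  by have := eq_a j; rewrite !ffunE.
by have := eq_b j; rewrite !ffunE.
Qed.

Lemma box_idx_surj N u : (wt u <= N)%N -> exists u' : box N, box_idx u' = u.
Proof.
move=> le_u; exists ([ffun j => inord (u.1 j)], [ffun j => inord (u.2 j)]).
case: u le_u => a b le_u; congr (_, _); apply/ffunP=> j;
  by rewrite !ffunE inordK // ltnS; have := leq_wt (a, b) j; move: le_u => /=; lia.
Qed.

Lemma poly_le_box N d f : (d <= N)%N -> poly_le d f ->
  exists c : box N -> R, forall z, f z = \sum_(u : box N) c u * mon (box_idx u) z.
Proof.
move=> ledN; elim=> {f} [c u le_u|f g _ [c fE] _ [c' gE]|f g fg _ [c fE]].
- have [u' <-] := box_idx_surj (leq_trans le_u ledN).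
  exists (fun u : box N => if u == u' then c else 0) => z.
  rewrite (bigD1 u') //= eqxx big1 ?addr0 // => i /negPf->.
  by rewrite mul0r.
- exists (fun u : box N => c u + c' u) => z.
  by rewrite fE gE -big_split; apply: eq_bigr => i _; rewrite mulrDl.
- by exists c => z; rewrite -fg.
Qed.

End Monomials.

(** Cancelling a power of the scaling parameter among polynomials also covers the parameter 0. *)
Lemma polyXn_cancel (R : idomainType) d e (c : R) (q : {poly R}) :
  'X^e * q = c *: 'X^d -> if (e <= d)%N then q = c *: 'X^(d - e) else c = 0.
Proof.
case: leqP => [led | ltd] eq_q.
  apply: (mulfI (monic_neq0 (monicXn _ e))); rewrite eq_q.
  by rewrite -scalerAr -exprD subnKC.
have := congr1 (fun p : {poly R} => p`_d) eq_q.
by rewrite coefXnM ltd coefZ coefXn eqxx mulr1.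
Qed.

(** * Functions on sequences of points and their expansion in one point *)

Section SpFunctions.
Variables (R : realFieldType) (n : nat).
Implicit Types (f g : seq (point R n) -> R) (X Y : seq (point R n)).
Implicit Types (z w : point R n) (t : R) (ab : abidx n).

(** Moves of one point to the front generate all permutations. *)
Definition symfun f := forall X z Y, f (X ++ z :: Y) = f (z :: X ++ Y).

Variables (N k : nat) (zs : 'I_k -> point R n) (C : box n N -> 'I_k -> R).
Hypothesis CE : forall u u', \sum_s C u s * mon (box_idx u') (zs s) = (u == u')%:R.
Implicit Types (u v : box n N) (c : box n N -> R).

Local Notation bmon u := (mon (box_idx u)).
Local Notation bwt u := (wt (box_idx u)).

(** By [CE], the coefficient of the monomial [u] in a combination [h] of box monomials. *)
Definition coef (h : point R n -> R) u : R := \sum_s C u s * h (zs s).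

Lemma coef_box h c : (forall z, h z = \sum_u c u * bmon u z) -> coef h =1 c.
Proof.
move=> hE u; rewrite /coef.
under eq_bigr => s _ do rewrite hE mulr_sumr.
rewrite exchange_big (bigD1 u) //= [X in _ + X]big1 ?addr0 => [|u' /negPf neq_u] /=.
  under eq_bigr => s _ do rewrite mulrCA.
  by rewrite -mulr_sumr CE eqxx mulr1.
under eq_bigr => s _ do rewrite mulrCA.
by rewrite -mulr_sumr CE eq_sym neq_u mulr0.
Qed.

Lemma box_uniq c c' :
  (forall z, \sum_u c u * bmon u z = \sum_u c' u * bmon u z) -> c =1 c'.
Proof.
move=> cc' u; rewrite -(coef_box (h := fun z => \sum_u c u * bmon u z)) //.
by apply: coef_box => z; rewrite cc'.
Qed.

(** The function f_u of the expansion of f(z, X). As a fixed combination of the [f (zs s :: X)], it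
    inherits properties of [f] termwise. *)
Definition slice f u X : R := coef (fun z => f (z :: X)) u.

(** What the induction uses of a homogeneous element of degree [d]. In [sp_tpoly] the prefix stays
    unscaled so that interpolation nodes can be put there when slicing. *)
Record sp_fun d f : Prop := SpFun {
  sp_sym : symfun f;
  sp_deg : forall z X, degenerate z -> f (z :: X) = f X;
  sp_box : forall X, exists c, forall z, f (z :: X) = \sum_u c u * bmon u z;
  sp_tpoly : forall X Y, exists q : {poly R},
    forall t, f (X ++ map (scale t) Y) = q.[t];
  sp_hom : forall t X, f (map (scale t) X) = t ^+ d * f X }.

Lemma slice_expand d f z X : sp_fun d f ->
  f (z :: X) = \sum_u slice f u X * bmon u z.
Proof.
move=> Sf; have [c cE] := sp_box Sf X; rewrite cE.
by apply: eq_bigr => u _; rewrite /slice (coef_box cE).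
Qed.

Lemma slice_tpoly d f u X Y : sp_fun d f -> exists q : {poly R},
    forall t, slice f u (X ++ map (scale t) Y) = q.[t].
Proof.
(* A polynomial is only known to exist for each node; induction on the number of nodes adds them up
   without choice. *)
move=> Sf; suff H m (zs' : 'I_m -> point R n) (C' : 'I_m -> R) :
    exists q : {poly R}, forall t,
      \sum_s C' s * f (zs' s :: X ++ map (scale t) Y) = q.[t] by exact: H.
elim: m zs' C' => [|m IHm] zs' C'.
  by exists 0 => t; rewrite big_ord0 horner0.
have [q qE] := sp_tpoly Sf (zs' ord0 :: X) Y.
have [q' q'E] := IHm (fun s => zs' (lift ord0 s)) (fun s => C' (lift ord0 s)).
exists (C' ord0 *: q + q') => t.
by rewrite big_ord_recl hornerD hornerZ -qE -q'E.
Qed.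

(** Compare the coefficients in z of f(tz, tX) = t^d f(z, X). *)
Lemma slice_homX d f u X t : sp_fun d f ->
  t ^+ bwt u * slice f u (map (scale t) X) = t ^+ d * slice f u X.
Proof.
move=> Sf; move: u; apply: box_uniq => z.
transitivity (f (scale t z :: map (scale t) X)).
  rewrite (slice_expand _ _ Sf); apply: eq_bigr => u _.
  by rewrite mon_scale; ring.
rewrite -[_ :: _]/(map (scale t) (z :: X)) (sp_hom Sf) (slice_expand _ _ Sf).
by rewrite mulr_sumr; apply: eq_bigr => u _; rewrite mulrA.
Qed.

Lemma slice_hom d f u X : sp_fun d f ->
  if (bwt u <= d)%N
  then forall t, slice f u (map (scale t) X) = t ^+ (d - bwt u) * slice f u X
  else slice f u X = 0.
Proof.
move=> Sf; have [q qE] := slice_tpoly u [::] X Sf.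
have : 'X^(bwt u) * q = slice f u X *: 'X^d.
  apply/eqP; rewrite -subr_eq0; apply/eqP/poly_eq0_eval => t.
  rewrite hornerD hornerN hornerM hornerZ !hornerXn -qE.
  by rewrite (slice_homX _ _ _ Sf) mulrC subrr.
move/polyXn_cancel; case: leqP => // _ q_eq t.
by rewrite (qE t) q_eq hornerZ hornerXn mulrC.
Qed.

Lemma slice_gt d f u X : sp_fun d f -> (d < bwt u)%N -> slice f u X = 0.
Proof. by move=> Sf lt_u; have := slice_hom u X Sf; rewrite leqNgt lt_u. Qed.

Lemma slice_eq0 f u X : (forall Z, f Z = 0) -> slice f u X = 0.
Proof. by move=> f0; rewrite /slice /coef big1 // => s _; rewrite f0 mulr0. Qed.

Lemma sp_fun_slice d f u : sp_fun d f -> (bwt u <= d)%N ->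
  sp_fun (d - bwt u) (slice f u).
Proof.
move=> Sf le_u; split.
- move=> X z Y; apply: eq_bigr => s _; congr (_ * _).
  by rewrite -cat_cons (sp_sym Sf) /= (sp_sym Sf [:: z]).
- move=> z X zdeg; apply: eq_bigr => s _; congr (_ * _).
  by rewrite (sp_sym Sf [:: zs s]) /= (sp_deg Sf).
- move=> X; exists (fun v => \sum_s C u s * slice f v (zs s :: X)) => z.
  under [RHS]eq_bigr => v _ do rewrite mulr_suml.
  rewrite exchange_big; apply: eq_bigr => s _ /=.
  rewrite (sp_sym Sf [:: zs s]) /= (slice_expand _ _ Sf) mulr_sumr.
  by apply: eq_bigr => v _; rewrite mulrA.
- by move=> X Y; apply: slice_tpoly Sf.
- by move=> t X; have := slice_hom u X Sf; rewrite le_u => ->.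
Qed.

(** Both sides are double sums of [f] over two nodes, which symmetry exchanges. *)
Lemma slice_comm f u v X : symfun f ->
  slice (slice f u) v X = slice (slice f v) u X.
Proof.
move=> Sf; rewrite /slice /coef.
under eq_bigr => s _ do rewrite mulr_sumr.
under [RHS]eq_bigr => s _ do rewrite mulr_sumr.
rewrite exchange_big; apply: eq_bigr => s _; apply: eq_bigr => s' _ /=.
by rewrite mulrCA (Sf [:: zs s]).
Qed.

(* On points with [eta_j = 0] both [f (z :: X) - f X] and all monomials
   involving [eta_j] vanish, hence so do the coefficients of the others. *)
Lemma slice_nonadmissible d f u X (j : 'I_n) : sp_fun d f ->
  (box_idx u).1 j = 0%N -> box_idx u <> idx0 n -> slice f u X = 0.
Proof.
move=> Sf u0 un0; have [v0 v0E] : exists v0 : box n N, box_idx v0 = idx0 n.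
  by apply: box_idx_surj; rewrite wt0.
suff /(_ u) : (fun v => if (box_idx v).1 j == 0%N then slice f v X else 0) =1
    (fun v => if v == v0 then f X else 0).
  by rewrite u0 eqxx; case: eqP => // eu; case: un0; rewrite eu.
(* [z0] is [z] with eta_j set to 0 and the other eta and xi kept. Being degenerate, it gives
   [f (z0 :: X) = f X], while expanding deletes the monomials involving eta_j. *)
apply: box_uniq => z; pose z0 : point R n := of_eta_xi
  (fun i => if i == j then 0 else z.2 i - z.1 i) (fun i => z.2 i + z.1 i).
have z0deg : degenerate z0 by exists j; rewrite /= eqxx; field.
have monz0 v : bmon v z0 = if (box_idx v).1 j == 0%N then bmon v z else 0.
  rewrite mon_of_eta_xi; case: eqP => [v0j | /eqP v0j].
    by apply: eq_bigr => i _; case: eqP => // ->; rewrite v0j !expr0.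
  by rewrite (bigD1 j) //= eqxx expr0n (negPf v0j) mul0r mul0r.
transitivity (f (z0 :: X)).
  rewrite (slice_expand _ _ Sf); apply: eq_bigr => v _.
  by rewrite monz0; case: ifP => _; rewrite ?mulr0 ?mul0r.
rewrite (sp_deg Sf) // (bigD1 v0) //= eqxx v0E mon0 mulr1 big1 ?addr0 //.
by move=> v /negPf->; rewrite mul0r.
Qed.

(* Sum of [G z_i (X \ z_i)] over the positions [i] of [X]. *)
Fixpoint pick_sum (G : point R n -> seq (point R n) -> R) X : R :=
  if X is z :: X' then G z X' + pick_sum (fun w Y => G w (z :: Y)) X' else 0.

Lemma eq_pick_sum G H X : (forall z Y, G z Y = H z Y) ->
  pick_sum G X = pick_sum H X.
Proof.
elim: X G H => [|z X IHX] G H GH //=.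
by rewrite GH (IHX _ (fun w Y => H w (z :: Y))).
Qed.

Lemma pick_sum_lin (I : finType) (G : I -> point R n -> seq (point R n) -> R)
    (a : I -> R) X :
  pick_sum (fun w Y => \sum_i a i * G i w Y) X = \sum_i a i * pick_sum (G i) X.
Proof.
elim: X G => [|z X IHX] G /=; first by rewrite big1 // => i _; rewrite mulr0.
rewrite (IHX (fun i w Y => G i w (z :: Y))) -big_split /=.
by apply: eq_bigr => i _; rewrite mulrDr.
Qed.

(** Symmetry lets the picked point return to its place, so each term sees the whole of [X]. *)
Lemma pick_sum_sym (G : point R n -> seq (point R n) -> R) X :
  (forall z, symfun (G z)) ->
  pick_sum (fun z Y => G z (z :: Y)) X = \sum_(z <- X) G z X.
Proof.
elim: X G => [|z X IHX] G Gsym; first by rewrite big_nil.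
rewrite big_cons /=; congr (_ + _).
rewrite -(IHX (fun w Y => G w (z :: Y))).
  by apply: eq_pick_sum => w Y; rewrite (Gsym w [:: z]).
by move=> w X1 w' X2; rewrite -cat_cons Gsym /= (Gsym w [:: w']).
Qed.

(* Euler's identity for homogeneous functions, with the Euler operator of each
   block expressed through the monomial expansion in that block. *)
Lemma sp_fun_euler d f X : sp_fun d f ->
  d%:R * f X = pick_sum (fun z Y => \sum_u (bwt u)%:R * (bmon u z * slice f u Y)) X.
Proof.
elim: X d f => [|z X IHX] d f Sf /=.
  (* The empty sequence is fixed by scaling with 0, so [f [::]] vanishes when [d] is positive. *)
  have := sp_hom Sf 0 [::]; case: (posnP d) => [->|d_gt0]; first by rewrite mul0r.
  by rewrite /= expr0n gtn_eqF // mul0r => ->; rewrite mulr0.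
(* Expanding in [z] too exposes the Euler sum of each [slice f v], worth [d - wt v] by induction;
   the head term supplies the missing [wt v]. *)
rewrite (@eq_pick_sum _ (fun w Y => \sum_v bmon v z *
    (\sum_u (bwt u)%:R * (bmon u w * slice (slice f v) u Y)))); last first.
  move=> w Y; under [RHS]eq_bigr => v _ do rewrite mulr_sumr.
  rewrite exchange_big; apply: eq_bigr => u _ /=.
  have [le_u|lt_u] := leqP (bwt u) d; last first.
    rewrite (slice_gt _ Sf lt_u) !mulr0 big1 // => v _.
    rewrite slice_comm; last exact: sp_sym Sf.
    rewrite slice_eq0 ?mulr0 // => Z.
    exact: slice_gt Sf lt_u.
  rewrite (slice_expand _ _ (sp_fun_slice Sf le_u)) !mulr_sumr.
  apply: eq_bigr => v _; rewrite (slice_comm v u); last exact: sp_sym Sf.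
  by ring.
rewrite pick_sum_lin -big_split /= (slice_expand _ _ Sf) mulr_sumr.
apply: eq_bigr => v _.
have [le_v|lt_v] := leqP (bwt v) d.
  by rewrite -(IHX _ _ (sp_fun_slice Sf le_v)) natrB //; ring.
(* The empty sum is zero in the shape that [pick_sum_lin] accepts. *)
rewrite (slice_gt _ Sf lt_v) (@eq_pick_sum _ (fun w Y => \sum_(i < 0) 0 * 0)).
  by rewrite pick_sum_lin big_ord0; ring.
move=> w Y; rewrite big_ord0 big1 // => u _.
by rewrite slice_eq0 ?mulr0 // => Z; apply: slice_gt Sf lt_v.
Qed.

(** * The algebra of admissible power sums, and generation *)

Definition psum ab X : R := \sum_(z <- X) mon ab z.

Inductive psum_gen : (seq (point R n) -> R) -> Prop :=
| psum_gen_const a : psum_gen (fun=> a)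
| psum_gen_psum ab : admissible ab -> psum_gen (psum ab)
| psum_gen_add f g : psum_gen f -> psum_gen g -> psum_gen (fun X => f X + g X)
| psum_gen_mul f g : psum_gen f -> psum_gen g -> psum_gen (fun X => f X * g X)
| psum_gen_ext f g : f =1 g -> psum_gen f -> psum_gen g.

Lemma psum_gen_sum (I : finType) (P : pred I) (F : I -> seq (point R n) -> R) :
  (forall i, P i -> psum_gen (F i)) ->
  psum_gen (fun X => \sum_(i | P i) F i X).
Proof.
move=> PF; suff H (s : seq I) : psum_gen (fun X => \sum_(i <- s | P i) F i X).
  exact: H.
elim: s => [|i s IHs].
  by apply: psum_gen_ext (psum_gen_const 0) => X; rewrite big_nil.
case Pi: (P i); last by apply: psum_gen_ext IHs => X; rewrite big_cons Pi.
by apply: psum_gen_ext (psum_gen_add (PF i Pi) IHs) => X; rewrite big_cons Pi.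
Qed.

(** Weights that may be inserted into an admissible power sum without leaving the algebra;
    quantifying over them lets products be treated one factor at a time. *)
Definition psum_weighted (H : point R n -> seq (point R n) -> R) := forall ab,
  admissible ab -> psum_gen (fun X => \sum_(z <- X) mon ab z * H z X).

(* [g z (z :: X) = f X] expresses [f (X \ z)] through [X] and [z]: substitute
   [psum ab X - mon ab z] for each [psum ab]. *)
Lemma psum_gen_remove f : psum_gen f ->
  exists g : point R n -> seq (point R n) -> R,
    [/\ forall z X, g z (z :: X) = f X, forall z, symfun (g z) &
        forall H, psum_weighted H -> psum_weighted (fun z X => H z X * g z X)].
Proof.
elim=> {f} [a|ab adm|f1 f2 _ [g1 [E1 S1 W1]] _ [g2 [E2 S2 W2]]
  |f1 f2 _ [g1 [E1 S1 W1]] _ [g2 [E2 S2 W2]]|f f' ff' _ [g [E S W]]].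
- exists (fun _ _ => a); split=> // H WH ab adm.
  apply: psum_gen_ext (psum_gen_mul (WH ab adm) (psum_gen_const a)) => X.
  by rewrite mulr_suml; apply: eq_bigr => z _; rewrite mulrA.
- exists (fun z X => psum ab X - mon ab z); split=> [z X|z X z' Y|H WH ab' adm'].
  + by rewrite /psum big_cons addrC addKr.
  + by rewrite /psum big_cons !big_cat big_cons /=; ring.
  (* [psum ab X] factors out of the sum, and [mon ab z] merges with [mon ab' z] into an admissible
     monomial. *)
  + apply: psum_gen_ext (psum_gen_add
      (psum_gen_mul (psum_gen_psum adm) (WH ab' adm'))
      (psum_gen_mul (psum_gen_const (-1)) (WH _ (admissibleDl ab adm')))) => X.
    rewrite mulr_sumr mulr_sumr -big_split; apply: eq_bigr => z _ /=.
    by rewrite monD; ring.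
- exists (fun z X => g1 z X + g2 z X); split=> [z X|z X z' Y|H WH ab' adm'].
  + by rewrite E1 E2.
  + by rewrite S1 S2.
  + apply: psum_gen_ext (psum_gen_add (W1 H WH _ adm') (W2 H WH _ adm')) => X.
    by rewrite -big_split; apply: eq_bigr => z _ /=; ring.
- exists (fun z X => g1 z X * g2 z X); split=> [z X|z X z' Y|H WH ab' adm'].
  + by rewrite E1 E2.
  + by rewrite S1 S2.
  + apply: psum_gen_ext (W2 _ (W1 H WH) _ adm') => X.
    by apply: eq_bigr => z _ /=; ring.
- by exists g; split=> // z X; rewrite E.
Qed.

Lemma sp_fun_psum_gen d f : (0 < n)%N -> sp_fun d f -> psum_gen f.
Proof.
move=> n_gt0; have [m] := ubnP d; elim: m d f => // m IHm d f le_dm Sf.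
have [d0|d_gt0] := posnP d.
  apply: psum_gen_ext (psum_gen_const (f [::])) => X.
  have := sp_hom Sf 0 X; rewrite d0 mul1r => <-.
  elim: X => //= z X ->; rewrite (sp_deg Sf) //.
  by exists (Ordinal n_gt0); rewrite /= !mul0r.
pose good u := [&& [forall j, (0 < (box_idx u).1 j)%N] & (bwt u <= d)%N].
have part u : good u -> psum_gen (pick_sum (fun z Y => bmon u z * slice f u Y)).
  case/andP=> /forallP adm le_u.
  (* Positive weight makes the degree of the slice strictly smaller, as the induction requires. *)
  have wt_gt0 : (0 < bwt u)%N.
    apply: leq_trans (leq_wt _ (Ordinal n_gt0)).
    by rewrite addn_gt0 (adm (Ordinal n_gt0)).
  have [|g [gE gS gW]] := psum_gen_remove (IHm _ _ _ (sp_fun_slice Sf le_u)).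
    by rewrite -ltnS; apply: leq_trans le_dm; lia.
  have W1 : psum_weighted (fun _ _ => 1).
    move=> ab admab; apply: psum_gen_ext (psum_gen_psum admab) => X.
    by apply: eq_bigr => z _; rewrite mulr1.
  apply: psum_gen_ext (gW _ W1 (box_idx u) adm) => X.
  rewrite -(pick_sum_sym (G := fun z Y => bmon u z * (1 * g z Y))).
    by apply: eq_pick_sum => z Y; rewrite gE mul1r.
  by move=> z X1 w X2; rewrite gS.
apply: psum_gen_ext (psum_gen_mul (psum_gen_const d%:R^-1)
  (psum_gen_sum (P := good) (F := fun u X => (bwt u)%:R *
     pick_sum (fun z Y => bmon u z * slice f u Y) X) _)) => [X|u gu]; last first.
  exact: psum_gen_mul (psum_gen_const _) (part u gu).
apply: (mulfI (x := d%:R)); first by rewrite pnatr_eq0 -lt0n.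
rewrite mulrA divff ?mul1r ?pnatr_eq0 -?lt0n // (sp_fun_euler _ Sf) pick_sum_lin.
rewrite big_mkcond; apply: eq_bigr => u _ /=; case: ifP => // /negbT.
(* The indices left out contribute nothing: the constant monomial has weight 0, the others have zero
   slices. *)
rewrite negb_and => /orP[/forallPn[j] | ltd].
  rewrite -eqn0Ngt => /eqP u0.
  have [eu|/eqP neu] := eqVneq (box_idx u) (idx0 n); first by rewrite eu wt0 mul0r.
  rewrite (@eq_pick_sum _ (fun w Y => \sum_(i < 0) 0 * 0)).
    by rewrite pick_sum_lin big_ord0 mulr0.
  by move=> z Y; rewrite (slice_nonadmissible Y Sf u0 neu) big_ord0 mulr0.
rewrite (@eq_pick_sum _ (fun w Y => \sum_(i < 0) 0 * 0)).
  by rewrite pick_sum_lin big_ord0 mulr0.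
by move=> z Y; rewrite (slice_gt _ Sf) ?ltnNge // big_ord0 mulr0.
Qed.

End SpFunctions.

(** * Homogeneous polynomials *)

Section Homogeneous.
Variable R : comNzRingType.

Lemma mhom0 k d : mhom (R := R) d (0 : mpoly R k).
Proof.
elim: k d => [|k IHk] d /=; first by rewrite eqxx.
by move=> i; rewrite coef0; split.
Qed.

Lemma mhomD k d (p q : mpoly R k) : mhom d p -> mhom d q -> mhom d (p + q).
Proof.
elim: k d p q => [|k IHk] d p q /= hp hq.
  have [-> | /hp->//] := eqVneq p 0; rewrite add0r; exact: hq.
move=> i; have [p0 hpi] := hp i; have [q0 hqi] := hq i; rewrite coefD.
by split=> [ltdi|]; [rewrite p0 // q0 // addr0 | apply: IHk].
Qed.

Lemma mhomN k d (p : mpoly R k) : mhom d p -> mhom d (- p).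
Proof.
elim: k d p => [|k IHk] d p /= hp; first by rewrite oppr_eq0.
move=> i; have [p0 hpi] := hp i; rewrite coefN.
by split=> [ltdi|]; [rewrite p0 // oppr0 | apply: IHk].
Qed.

Lemma mhom_sum k d (I : Type) (r : seq I) (P : pred I) (F : I -> mpoly R k) :
  (forall i, P i -> mhom d (F i)) -> mhom d (\sum_(i <- r | P i) F i).
Proof. by move=> hF; apply: big_ind hF => [|p q]; [apply: mhom0 | apply: mhomD]. Qed.

Lemma mhomM k d e (p q : mpoly R k) :
  mhom d p -> mhom e q -> mhom (d + e) (p * q).
Proof.
elim: k d e p q => [|k IHk] d e p q /= hp hq.
  move=> pq0; rewrite hp; last by apply: contraNneq pq0 => ->; rewrite mul0r.
  by rewrite hq //; apply: contraNneq pq0 => ->; rewrite mulr0.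
move=> i; rewrite coefM; split=> [ltdi|].
  rewrite big1 // => j _; have [ltdj|lejd] := ltnP d j.
    by have [-> //] := hp j; rewrite mul0r.
  have [q0 _] := hq (i - j)%N; rewrite q0 ?mulr0 //.
  by have := ltn_ord j; lia.
apply: mhom_sum => j _; have lt_j := ltn_ord j.
have [p0 hpj] := hp j; have [q0 hqj] := hq (i - j)%N.
(* The truncated differences add up correctly only when both indices are within the degrees;
   otherwise a factor is zero. *)
have [ltdj|lejd] := ltnP d j; first by rewrite p0 // mul0r; apply: mhom0.
have [ltej|leje] := ltnP e (i - j); first by rewrite q0 // mulr0; apply: mhom0.
have -> : (d + e - i = (d - j) + (e - (i - j)))%N by lia.
exact: IHk.
Qed.

Lemma mhom_C k (r : R) : mhom 0 (mpC k r).
Proof.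
elim: k => [|k IHk] //= i; rewrite coefC sub0n.
by case: i => [|i] /=; split=> //; apply: mhom0.
Qed.

Lemma mhom1 k : mhom (R := R) 0 (1 : mpoly R k).
Proof. by rewrite -(rmorph1 (@mpC R k)); apply: mhom_C. Qed.

Lemma mhom_X k l : mhom 1 (mpX R k l).
Proof.
elim: k => [|k IHk] /=; first by rewrite eqxx.
case: ifP => _ i; first rewrite coefX; last rewrite coefC.
  by case: i => [|[|i]] /=; split=> //; rewrite ?subnn;
    [apply: mhom0 | apply: mhom1 | apply: mhom0].
by case: i => [|i] /=; split=> //; apply: mhom0.
Qed.

Lemma mhom_exp k d (p : mpoly R k) i : mhom d p -> mhom (i * d) (p ^+ i).
Proof.
move=> hp; elim: i => [|i IHi]; first exact: mhom1.
by rewrite exprS mulSn; apply: mhomM.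
Qed.

Lemma mhom_prod k (I : Type) (r : seq I) (F : I -> mpoly R k) (d : I -> nat) :
  (forall i, mhom (d i) (F i)) -> mhom (\sum_(i <- r) d i)%N (\prod_(i <- r) F i).
Proof.
move=> hF; elim: r => [|i r IHr]; first by rewrite !big_nil; apply: mhom1.
by rewrite !big_cons; apply: mhomM.
Qed.

Lemma mpEval_scale k d (p : mpoly R k) (t : R) v : mhom d p ->
  mpEval idfun (fun l => t * v l) p = t ^+ d * mpEval idfun v p.
Proof.
elim: k d p => [|k IHk] d p hp.
  by rewrite /=; have [->|/hp->] := eqVneq p 0; rewrite ?mulr0 ?mul1r.
rewrite !mpEvalS mulr_sumr; apply: eq_bigr => i _; have [p0 hpi] := hp i.
have [ltdi|leid] := ltnP d i; first by rewrite p0 // !rmorph0 !mul0r mulr0.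
by rewrite (IHk _ _ hpi) exprMn -{2}(subnK leid) exprD; ring.
Qed.

End Homogeneous.

Lemma mpEval_poly_le (R : realFieldType) n k d (p : mpoly R k)
    (v : nat -> point R n -> R) :
  (forall l, poly_le 1 (v l)) -> mhom d p ->
  poly_le d (fun z => mpEval idfun (v^~ z) p).
Proof.
move=> hv; elim: k d p => [|k IHk] d p hp.
  exact: (poly_le_const n d p).
apply: (@poly_le_ext _ _ _
  (fun z => \sum_(i < size (p : {poly mpoly R k})) mpEval idfun (v^~ z) p`_i * v k z ^+ i)).
  by move=> z; rewrite mpEvalS.
apply: poly_le_sum => i; have [p0 hpi] := hp i.
have [ltdi|leid] := ltnP d i.
  by apply: poly_le_ext (poly_le_const n d 0) => z; rewrite p0 // rmorph0 mul0r.
rewrite -{1}(subnK leid).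
exact: poly_le_mul (IHk _ _ hpi) (poly_le_exp i (hv k)).
Qed.

(** * From compatible families to functions on sequences of points *)

Section Families.
Variables (R : realFieldType) (n : nat).
Implicit Types (z : point R n) (X : seq (point R n)) (ab : abidx n).
Implicit Types (F G : fam R n) (v w : nat -> R).

Local Notation pt0 := ((fun=> 0, fun=> 0) : point R n).

Definition coord z (r : nat) : R :=
  match (insub r : option 'I_n) with
  | Some j => z.1 j
  | None => match (insub (r - n)%N : option 'I_n) with
            | Some j => z.2 j
            | None => 0
            end
  end.

Definition block v (i : nat) : point R n :=
  (fun j : 'I_n => v (i * (2 * n) + j)%N, fun j : 'I_n => v (i * (2 * n) + n + j)%N).

Lemma ptvalE X l : ptval X l = coord (nth pt0 X (l %/ (2 * n))) (l %% (2 * n)).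
Proof.
rewrite /ptval /coord; case: ltnP => // le_X; rewrite nth_default //.
by case: insubP => //; case: insubP.
Qed.

Lemma ptval_block X i r : (r < 2 * n)%N ->
  ptval X (i * (2 * n) + r) = coord (nth pt0 X i) r.
Proof.
move=> ltr; have n0 : (0 < 2 * n)%N by apply: leq_ltn_trans ltr.
by rewrite ptvalE divnMDl // divn_small // addn0 modnMDl modn_small.
Qed.

Lemma coord1 z (j : 'I_n) : coord z j = z.1 j.
Proof. by rewrite /coord valK. Qed.

Lemma coord2 z (j : 'I_n) : coord z (n + j) = z.2 j.
Proof. by rewrite /coord insubN -?leqNgt ?leq_addr // addKn valK. Qed.

Lemma eq_mon ab z z' : z.1 =1 z'.1 -> z.2 =1 z'.2 -> mon ab z = mon ab z'.
Proof. by move=> e1 e2; apply: eq_bigr => j _; rewrite e1 e2. Qed.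

Lemma mon_block ab v w i i' :
  (forall r, (r < 2 * n)%N -> v (i * (2 * n) + r)%N = w (i' * (2 * n) + r)%N) ->
  mon ab (block v i) = mon ab (block w i').
Proof.
by move=> vw; apply: eq_mon => j; rewrite /= -?addnA vw //; have := ltn_ord j; lia.
Qed.

Lemma mon_block_ptval ab X i : mon ab (block (ptval X) i) = mon ab (nth pt0 X i).
Proof.
apply: eq_mon => j; rewrite /= -?addnA ptval_block ?coord1 ?coord2 //;
  by have := ltn_ord j; lia.
Qed.

Lemma mon_pt0 ab : (0 < n)%N -> admissible ab -> mon ab pt0 = 0.
Proof.
move=> n_gt0 adm; rewrite /mon (bigD1 (Ordinal n_gt0)) //=.
by rewrite subr0 expr0n gtn_eqF ?adm // !mul0r.
Qed.

Lemma block_lt m l : (l < m * (2 * n))%N ->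
  (l %/ (2 * n) < m)%N /\ (l %% (2 * n) < 2 * n)%N.
Proof.
case: (posnP (2 * n)) => [->|n2]; first by rewrite muln0.
by move=> ltl; rewrite ltn_divLR // ltn_pmod.
Qed.

Lemma lt_block m i r : (i < m)%N -> (r < 2 * n)%N ->
  (i * (2 * n) + r < m * (2 * n))%N.
Proof.
move=> lti ltr; apply: leq_trans (_ : i.+1 * (2 * n) <= _)%N.
  by rewrite mulSn addnC ltn_add2r.
by rewrite leq_mul2r lti orbT.
Qed.

Lemma mpEval_permP m (s : 'S_m) (f : Pm R n m) v w :
  (forall (i : 'I_m) r, (r < 2 * n)%N ->
     w (i * (2 * n) + r)%N = v (s i * (2 * n) + r)%N) ->
  mpEval idfun v (Defs.permP s f) = mpEval idfun w f.
Proof.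
move=> vw; rewrite mpEval_comp; apply: eq_mpEval => l ltl.
have [lti ltr] := block_lt ltl; rewrite insubT /= mpEval_X.
  by rewrite -(vw (Ordinal lti)) //= -divn_eq.
exact: lt_block.
Qed.

Lemma mpEval_proj m (f : Pm R n m.+1) v :
  mpEval idfun v (proj f) =
  mpEval idfun (fun l => if (l < m * (2 * n))%N then v l else 0) f.
Proof.
rewrite mpEval_comp; apply: eq_mpEval => l _.
by case: ifP => [ltl|_]; rewrite ?mpEval_X // rmorph0.
Qed.

Lemma mpEval_pfam ab m v :
  mpEval idfun v (pfam R ab m) = \sum_(i < m.+1) mon ab (block v i).
Proof.
rewrite rmorph_sum; apply: eq_bigr => i _; rewrite rmorph_prod.
apply: eq_bigr => j _; have lti := ltn_ord i; have ltj := ltn_ord j.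
rewrite rmorphM !rmorphXn rmorphB rmorphD /= !mpEval_X //;
  by rewrite -?addnA lt_block //; lia.
Qed.

(** Admissible monomials vanish at the origin, so padding points add nothing. *)
Lemma mpEval_pfam_psum ab m X : (0 < n)%N -> admissible ab -> (size X <= m.+1)%N ->
  mpEval idfun (ptval X) (pfam R ab m) = psum ab X.
Proof.
move=> n_gt0 adm leX; rewrite mpEval_pfam /psum (big_nth pt0) big_mkord.
rewrite [RHS](big_ord_widen _ (fun i => mon ab (nth pt0 X i)) leX) [RHS]big_mkcond.
apply: eq_bigr => i _; rewrite mon_block_ptval; case: ltnP => // leXi.
by rewrite nth_default // mon_pt0.
Qed.

Lemma pfam_sym ab : fam_sym (pfam R ab).
Proof.
move=> m s; apply: mpoly_eq_eval => v.
pose w l := if (insub (l %/ (2 * n))%N : option 'I_m.+1) is Some i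
            then v (s i * (2 * n) + l %% (2 * n))%N else 0.
have wE (i : 'I_m.+1) r : (r < 2 * n)%N ->
    w (i * (2 * n) + r)%N = v (s i * (2 * n) + r)%N.
  move=> ltr; have n0 : (0 < 2 * n)%N by apply: leq_ltn_trans ltr.
  by rewrite /w divnMDl // divn_small // addn0 modnMDl modn_small // valK.
rewrite (mpEval_permP _ wE) !mpEval_pfam [RHS](reindex_inj (@perm_inj _ s)).
by apply: eq_bigr => i _; apply: mon_block => r ltr; rewrite wE.
Qed.

Lemma pfam_compat ab : (0 < n)%N -> admissible ab -> fam_compat (pfam R ab).
Proof.
move=> n_gt0 adm m; apply: mpoly_eq_eval => v.
rewrite mpEval_proj !mpEval_pfam big_ord_recr /= [X in _ + X](_ : _ = 0); last first.
  rewrite -[RHS](mon_pt0 n_gt0 adm); apply: eq_mon => j /=.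
    by rewrite ltnNge leq_addr.
  by rewrite ltnNge -addnA leq_addr.
rewrite addr0; apply: eq_bigr => i _; apply: mon_block => r ltr.
by rewrite lt_block.
Qed.

Lemma pfam_hom ab : fam_hom (wt ab) (pfam R ab).
Proof.
move=> m; apply: mhom_sum => i _; apply: mhom_prod => j.
apply: mhomM; rewrite -[X in mhom X _]muln1; apply: mhom_exp;
  by apply: mhomD; [|try apply: mhomN]; apply: mhom_X.
Qed.

Lemma pfam_inSp ab : (0 < n)%N -> admissible ab -> inSp (pfam R ab).
Proof.
move=> n_gt0 adm; split; last first.
  move=> X z [j zj]; rewrite /phi !mpEval_pfam_psum // /psum big_cons.
  rewrite [mon ab z](_ : _ = 0) ?add0r // /mon (bigD1 j) //= zj subrr expr0n.
  by rewrite gtn_eqF ?adm // !mul0r.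
exists (wt ab).+1, (fun d m => if d == wt ab then pfam R ab m else 0).
split=> [d|m]; last by rewrite big_ord_recr /= eqxx big1 ?add0r // => i _; rewrite ltn_eqF.
case: eqP => [->|_].
  by split; [apply: pfam_sym | split; [apply: pfam_compat | apply: pfam_hom]].
split; first by move=> m s; apply: rmorph0.
by split=> m; [apply: rmorph0 | apply: mhom0].
Qed.

Lemma phiE X F : phi X F = mpEval idfun (ptval X) (F (size X)).
Proof. by []. Qed.

Lemma phi_stable F X m : fam_compat F -> (size X <= m.+1)%N ->
  mpEval idfun (ptval X) (F m) = phi X F.
Proof.
move=> Fc; have step i : (size X <= i.+1)%N ->
    mpEval idfun (ptval X) (F i) = mpEval idfun (ptval X) (F i.+1).
  move=> leX; rewrite -{1}Fc mpEval_proj; apply: eq_mpEval => l ltl.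
  case: ltnP => // leil; rewrite /ptval ltnNge (leq_trans leX) //.
  have [n0|n2] := posnP (2 * n); last by rewrite leq_divRL.
  by rewrite n0 muln0 in ltl.
(* [phi] uses component [size X], which has one spare block; the tight case lies one component
   below, all others at or above. *)
rewrite leq_eqVlt => /predU1P[eqX|]; first by rewrite step ?eqX // /phi eqX.
rewrite ltnS => leXm; rewrite -(subnKC leXm); elim: (m - size X)%N => [|i <-].
  by rewrite addn0.
by rewrite addnS -step // leqW // leq_addr.
Qed.

Lemma phi_sym F : fam_sym F -> symfun (fun X => phi X F).
Proof.
move=> Fs X z Y; rewrite !phiE /=.
have -> : size (X ++ z :: Y) = (size (X ++ Y)).+1 by rewrite !size_cat addnS.
set m := (size (X ++ Y)).+1.
have leXm : (size X < m.+1)%N by rewrite /m size_cat; lia.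
(* The cycle carrying block 0 to block [size X] and keeping the other blocks in order. *)
pose s : 'S_m.+1 := lift_perm ord0 (Ordinal leXm) 1.
rewrite -[in LHS](Fs m s); apply: mpEval_permP => i r ltr.
rewrite !ptval_block //; congr (coord _ _).
case: (unliftP ord0 i) => [j ->|->]; last first.
  by rewrite lift_perm_id /= nth_cat ltnn subnn.
rewrite lift_perm_lift perm1 /= /bump /= !nth_cat /=.
have [leXj|ltjX] := leqP (size X) j.
  by rewrite /= !add1n ltnNge leqW //= subSn.
by rewrite /= !add0n ltjX.
Qed.

Lemma ptval_scale t X l : ptval (map (scale t) X) l = t * ptval X l.
Proof.
rewrite !ptvalE; set i := (l %/ _)%N.
have [ltX|leX] := ltnP i (size X).
  rewrite (nth_map pt0) // /coord /=.
  by case: insub => //=; case: insub => //; rewrite mulr0.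
rewrite !nth_default ?size_map // /coord.
by case: insub => [j|]; rewrite ?mulr0 //; case: insub => [j|]; rewrite mulr0.
Qed.

Lemma phi_scale d F t X : fam_hom d F ->
  phi (map (scale t) X) F = t ^+ d * phi X F.
Proof.
move=> Fh; rewrite !phiE size_map -(mpEval_scale _ _ (Fh _)).
by apply: eq_mpEval => l _; rewrite ptval_scale.
Qed.

Lemma phi_tpoly F X Y : fam_compat F -> exists q : {poly R},
  forall t, phi (X ++ map (scale t) Y) F = q.[t].
Proof.
(* Evaluate with coordinates in [{poly R}]: constant on [X], linear on [Y]. *)
move=> Fc; pose w l : {poly R} :=
  if (l %/ (2 * n) < size X)%N then (ptval X l)%:P
  else ptval Y (l - size X * (2 * n)) *: 'X.
exists (mpEval polyC w (F (size (X ++ Y)))) => t.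
rewrite -(@phi_stable F _ (size (X ++ Y))) ?size_cat ?size_map //.
rewrite -[RHS]/(horner_eval t _) (@rmorph_mpEval _ _ _ _ (horner_eval t) idfun).
  apply: eq_mpEval => l ltl; have [_ ltr] := block_lt ltl.
  have n2 : (0 < 2 * n)%N by apply: leq_ltn_trans ltr.
  rewrite /= /w; case: ltnP => [ltX|leX]; rewrite /horner_eval ?hornerC ?hornerZ ?hornerX.
    by rewrite !ptvalE nth_cat ltX.
  rewrite mulrC -ptval_scale !ptvalE nth_cat ltnNge leX /=.
  have -> : l = (size X * (2 * n) + (l - size X * (2 * n)))%N.
    by rewrite subnKC // -leq_divRL.
  by rewrite divnMDl // modnMDl !addKn.
by move=> r; rewrite /= /horner_eval hornerC.
Qed.

Lemma phi_poly_le d F X : fam_hom d F -> poly_le d (fun z => phi (z :: X) F).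
Proof.
move=> Fh; rewrite /phi /=.
apply: (mpEval_poly_le (v := fun l z => ptval (z :: X) l)) => // l.
have const0 : poly_le 1 (fun _ : point R n => 0) by apply: poly_le_const.
case Ei: (l %/ (2 * n))%N => [|i]; last first.
  apply: poly_le_ext (poly_le_const n 1 (coord (nth pt0 X i) (l %% (2 * n)))) => z.
  by rewrite ptvalE Ei.
apply: (@poly_le_ext _ _ _ (fun z => coord z (l %% (2 * n)))) => [z|].
  by rewrite ptvalE Ei.
rewrite /coord; case: insub => [j|]; first exact: (poly_le_coord R j).1.
by case: insub => [j|] //; exact: (poly_le_coord R j).2.
Qed.

Lemma phi_sp_fun N k (zs : 'I_k -> point R n) (C : box n N -> 'I_k -> R) d F :
  (d <= N)%N -> fam_sym F -> fam_compat F -> fam_hom d F ->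
  (forall z X, degenerate z -> phi (z :: X) F = phi X F) ->
  sp_fun N d (fun X => phi X F).
Proof.
move=> leN Fs Fc Fh Fd; split=> //.
- exact: phi_sym.
- by move=> X; apply: poly_le_box leN (phi_poly_le _ Fh).
- by move=> X Y; apply: phi_tpoly.
- by move=> t X; apply: phi_scale.
Qed.

Lemma phi_sum D (G : nat -> fam R n) F X :
  (forall m, F m = \sum_(d < D) G d m) -> phi X F = \sum_(d < D) phi X (G d).
Proof. by move=> FE; rewrite !phiE FE rmorph_sum. Qed.

(* Scaling all points by [t] turns the condition on [F] into a polynomial
   identity in [t] whose coefficients are the conditions on the [G d]. *)
Lemma degenerate_component D (G : nat -> fam R n) F :
  (forall d, fam_hom d (G d)) -> (forall m, F m = \sum_(d < D) G d m) ->
  (forall X z, degenerate z -> phi (z :: X) F = phi X F) ->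
  forall d z X, (d < D)%N -> degenerate z -> phi (z :: X) (G d) = phi X (G d).
Proof.
move=> Gh FE Fd d z X ltd zdeg.
pose q := \poly_(i < D) (phi (z :: X) (G i) - phi X (G i)).
suff /(congr1 (fun p : {poly R} => p`_d)) : q = 0.
  by rewrite coef_poly ltd coef0 => /eqP; rewrite subr_eq0 => /eqP.
apply: poly_eq0_eval => t; rewrite horner_poly.
have tzdeg : degenerate (scale t z) by case: zdeg => j zj; exists j; rewrite /= zj.
have /eqP := Fd (map (scale t) X) _ tzdeg.
rewrite -subr_eq0 -[_ :: _]/(map (scale t) (z :: X)) !(phi_sum _ FE) -sumrB => /eqP sum0.
rewrite -[RHS]sum0.
by apply: eq_bigr => i _; rewrite !(phi_scale _ _ (Gh i)); ring.
Qed.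

(** * Polynomials in the power sums: generation and independence for families *)

Definition psum_val k (idx : 'I_k -> abidx n) X (l : nat) : R :=
  if (insub l : option 'I_k) is Some i then psum (idx i) X else 0.

Lemma psum_valE k (idx : 'I_k -> abidx n) X l (ltl : (l < k)%N) :
  psum_val idx X l = psum (idx (Ordinal ltl)) X.
Proof. by rewrite /psum_val insubT. Qed.

Lemma mpEval_evalQ k (idx : 'I_k -> abidx n) (Q : mpoly R k) m X :
  (0 < n)%N -> (forall i, admissible (idx i)) -> (size X <= m.+1)%N ->
  mpEval idfun (ptval X) (evalQ idx Q m) = mpEval idfun (psum_val idx X) Q.
Proof.
move=> n_gt0 adm leX; rewrite mpEval_comp; apply: eq_mpEval => l ltl.
by rewrite /psum_val insubT mpEval_pfam_psum.
Qed.

Lemma psum_gen_mpoly f : psum_gen f ->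
  exists k (idx : 'I_k -> abidx n) (Q : mpoly R k),
    (forall i, admissible (idx i)) /\
    forall X, f X = mpEval idfun (psum_val idx X) Q.
Proof.
(* Sums and products need a common index list: concatenate the two and shift the variables of the
   second by [k1]. *)
have join k1 k2 (idx1 : 'I_k1 -> abidx n) (idx2 : 'I_k2 -> abidx n) :
    (forall i, admissible (idx1 i)) -> (forall i, admissible (idx2 i)) ->
  exists idx : 'I_(k1 + k2) -> abidx n,
    [/\ forall i, admissible (idx i),
      forall Q : mpoly R k1, exists Q' : mpoly R (k1 + k2), forall X,
        mpEval idfun (psum_val idx1 X) Q = mpEval idfun (psum_val idx X) Q' &
      forall Q : mpoly R k2, exists Q' : mpoly R (k1 + k2), forall X,
        mpEval idfun (psum_val idx2 X) Q = mpEval idfun (psum_val idx X) Q'].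
  move=> adm1 adm2.
  exists (fun i => match split i with inl i1 => idx1 i1 | inr i2 => idx2 i2 end).
  split=> [i|Q|Q]; first by case: split.
  - exists (mpEval (@mpC R _) (fun l => mpX R (k1 + k2) l) Q) => X.
    rewrite mpEval_comp; apply: eq_mpEval => l ltl.
    have ltl' : (l < k1 + k2)%N by rewrite ltn_addr.
    rewrite mpEval_X // !psum_valE.
    by case: split_ordP => i /(congr1 val) /= El;
      [congr (psum (idx1 _) X); apply: val_inj | move: ltl; rewrite El; lia].
  - exists (mpEval (@mpC R _) (fun l => mpX R (k1 + k2) (k1 + l)) Q) => X.
    rewrite mpEval_comp; apply: eq_mpEval => l ltl.
    have ltl' : (k1 + l < k1 + k2)%N by rewrite ltn_add2l.
    rewrite mpEval_X // !psum_valE.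
    case: split_ordP => i /(congr1 val) /= El; first by have := ltn_ord i; lia.
    by congr (psum (idx2 _) X); apply: val_inj => /=; lia.
elim=> {f} [a|ab adm|f1 f2 _ [k1 [i1 [Q1 [a1 E1]]]] _ [k2 [i2 [Q2 [a2 E2]]]]
  |f1 f2 _ [k1 [i1 [Q1 [a1 E1]]]] _ [k2 [i2 [Q2 [a2 E2]]]]
  |f f' ff' _ [k [idx [Q [adm E]]]]].
- by exists 0%N, (fun=> idx0 n), a; split=> // -[].
- exists 1%N, (fun=> ab), (mpX R 1 0); split=> // X.
  by rewrite mpEval_X // /psum_val insubT.
- have [idx [adm T1 T2]] := join _ _ _ _ a1 a2.
  have [Q1' E1'] := T1 Q1; have [Q2' E2'] := T2 Q2.
  exists (k1 + k2)%N, idx, (Q1' + Q2'); split=> // X.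
  by rewrite rmorphD /= -E1' -E2' -E1 -E2.
- have [idx [adm T1 T2]] := join _ _ _ _ a1 a2.
  have [Q1' E1'] := T1 Q1; have [Q2' E2'] := T2 Q2.
  exists (k1 + k2)%N, idx, (Q1' * Q2'); split=> // X.
  by rewrite rmorphM /= -E1' -E2' -E1 -E2.
- by exists k, idx, Q; split=> // X; rewrite -ff'.
Qed.

(** Every assignment of the variables comes from points, so equality of values on sequences gives
    equality of polynomials. *)
Lemma exists_ptval v m : exists X, size X = m /\
  forall l, (l < m * (2 * n))%N -> ptval X l = v l.
Proof.
exists (mkseq (block v) m); split=> [|l ltl]; first by rewrite size_mkseq.
have [lti ltr] := block_lt ltl.
rewrite ptvalE nth_mkseq // /coord.
case: insubP => [j _ jE|ge_r]; first by rewrite /= jE -divn_eq.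
rewrite -leqNgt in ge_r; case: insubP => [j _ jE|]; last by lia.
by rewrite /= jE -addnA subnKC // -divn_eq.
Qed.

Lemma sp_generated F : (0 < n)%N -> inSp F ->
  exists k (idx : 'I_k -> abidx n) (Q : mpoly R k),
    (forall i, admissible (idx i)) /\ (forall m, F m = evalQ idx Q m).
Proof.
move=> n_gt0 [[D [G [hG FE]]] Fd].
have [k [zs [C CE]]] := mon_interpolation R (@box_idx_inj n D).
have Fgen : psum_gen (fun X => phi X F).
  apply: psum_gen_ext (psum_gen_sum (P := xpredT)
    (F := fun (d : 'I_D) X => phi X (G d)) _) => [X|d _].
    by rewrite (phi_sum _ FE).
  have [Gs [Gc Gh]] := hG d.
  apply: (sp_fun_psum_gen CE n_gt0).
  apply: (phi_sp_fun zs C (d := d)) => //; first exact: ltnW.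
  move=> z X; apply: (degenerate_component _ FE Fd) => // e.
  by have [_ []] := hG e.
have Fc : fam_compat F.
  move=> m; rewrite !FE /proj rmorph_sum; apply: eq_bigr => d _.
  by have [_ [Gc _]] := hG d; apply: Gc.
have [k' [idx [Q [adm QE]]]] := psum_gen_mpoly Fgen.
exists k', idx, Q; split=> // m; apply: mpoly_eq_eval => v.
have [X [sX Xv]] := exists_ptval v m.+1.
rewrite -!(eq_mpEval _ Xv) mpEval_evalQ ?sX // -QE.
by apply: phi_stable; rewrite ?sX.
Qed.

(* The set of vectors [(psum (idx i) X)_i] is closed under addition and spans,
   so a polynomial vanishing on it vanishes everywhere: replace real weights of
   points by multiplicities one at a time. *)
Lemma psum_dense k (idx : 'I_k -> abidx n) (Q : mpoly R k)
    (s : seq (R * point R n)) X :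
  mpEval idfun (fun l => if (insub l : option 'I_k) is Some i
     then \sum_(tz <- s) tz.1 * mon (idx i) tz.2 + psum (idx i) X else 0) Q != 0 ->
  exists Y, mpEval idfun (psum_val idx Y) Q != 0.
Proof.
elim: s X => [|[t z] s IHs] X.
  move=> Q0; exists X; apply: contraNneq Q0 => QX; rewrite -[X in _ == X]QX.
  apply/eqP/eq_mpEval => l _; rewrite /psum_val.
  by case: insub => // i; rewrite big_nil add0r.
(* The weight of the head point [z] becomes an indeterminate. *)
pose w l : {poly R} := if (insub l : option 'I_k) is Some i
  then mon (idx i) z *: 'X +
    (\sum_(tz <- s) tz.1 * mon (idx i) tz.2 + psum (idx i) X)%:P else 0.
have wE x : (mpEval polyC w Q).[x] =
    mpEval idfun (fun l => if (insub l : option 'I_k) is Some i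
     then \sum_(tz <- (x, z) :: s) tz.1 * mon (idx i) tz.2 + psum (idx i) X else 0) Q.
  rewrite -[LHS]/(horner_eval x _) (@rmorph_mpEval _ _ _ _ (horner_eval x) idfun).
    apply: eq_mpEval => l _; rewrite /= /horner_eval /w.
    case: insub => [i|]; last by rewrite horner0.
    by rewrite hornerD hornerZ hornerX hornerC big_cons /=; ring.
  by move=> r; rewrite /= /horner_eval hornerC.
rewrite -wE => Q0; have [|c Qc] := @poly_neq0_nat _ (mpEval polyC w Q).
  by apply: contraNneq Q0 => ->; rewrite horner0.
(* A natural weight [c] is realised by [c] copies of [z]. *)
apply: (IHs (nseq c z ++ X)); apply: contraNneq Qc => Q0'; rewrite wE -[X in _ == X]Q0'.
apply/eqP/eq_mpEval => l _; case: insub => // i.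
rewrite big_cons /psum big_cat big_nseq /= -addrA addrCA; congr (_ + (_ + _)).
by rewrite mulr_natl -Monoid.iteropE.
Qed.

Lemma pfam_algebraic_independence k (idx : 'I_k -> abidx n) (Q : mpoly R k) :
  (0 < n)%N -> injective idx -> (forall i, admissible (idx i)) -> Q != 0 ->
  exists m, evalQ idx Q m != 0.
Proof.
move=> n_gt0 idx_inj adm Q0.
have [v Qv] := mpoly_neq0_eval Q0.
have [K [zs [C CE]]] := mon_interpolation R idx_inj.
(* By [CE], these weights make the weighted power sum of index [idx i] equal to [v i]. *)
pose s := [seq (\sum_(i < k) v i * C i p, zs p) | p : 'I_K].
have [Y QY] : exists Y, mpEval idfun (psum_val idx Y) Q != 0.
  apply: (@psum_dense _ _ _ s [::]); apply: contraNneq Qv => Qs.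
  rewrite -[X in _ == X]Qs; apply/eqP/eq_mpEval => l ltl.
  rewrite insubT big_map /psum big_nil addr0 /=.
  rewrite big_enum /=; under eq_bigr => p _ do rewrite mulr_suml.
  rewrite exchange_big (bigD1 (Ordinal ltl)) //= [X in _ + X]big1 ?addr0 => [|i /negPf ni] /=.
    under eq_bigr => p _ do rewrite -mulrA.
    by rewrite -mulr_sumr CE eqxx mulr1.
  under eq_bigr => p _ do rewrite -mulrA.
  by rewrite -mulr_sumr CE ni mulr0.
exists (size Y); apply: contraNneq QY => Q1.
by rewrite -(@mpEval_evalQ _ _ _ (size Y)) // Q1 rmorph0.
Qed.

End Families.

Theorem theorem2p7 (R : realFieldType) (n : nat) (hn : (1 <= n)%N) :
  (* each generator p_{a,b} (a in N_+^n, b in N^n) lies in A_fin[~Sp(A^1_n)] *)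
  (forall ab : abidx n, admissible ab -> inSp (pfam R ab)) /\
  (* the p_{a,b} are algebraically independent over R *)
  (forall (k : nat) (idx : 'I_k -> abidx n) (Q : mpoly R k),
     injective idx -> (forall i : 'I_k, admissible (idx i)) -> Q != 0 ->
     exists m : nat, evalQ idx Q m != 0) /\
  (* the p_{a,b} generate A_fin[~Sp(A^1_n)] as an R-algebra *)
  (forall F : fam R n, inSp F ->
     exists (k : nat) (idx : 'I_k -> abidx n) (Q : mpoly R k),
       (forall i : 'I_k, admissible (idx i)) /\
       (forall m : nat, F m = evalQ idx Q m)).
Proof.
split; first by move=> ab; apply: pfam_inSp.
split; first by move=> k idx Q; apply: pfam_algebraic_independence.
by move=> F; apply: sp_generated.
Qed.
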